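(* Let $g, b \in \mathbb{R}$ and let $v_i^l \le v_i^u$, $v_j^l \le v_j^u$, $c^l \le c^u$, $s^l \le s^u$ be real numbers. Let $B = [v_i^l,v_i^u]\times[v_j^l,v_j^u]\times[c^l,c^u]\times[s^l,s^u]$ and let $G = \{(z,v_i,v_j,c,s)\in\mathbb{R}^5 : (v_i,v_j,c,s)\in B,\ z = -g\,v_i v_j c + b\,v_i v_j s\}$. Then the strengthened QC relaxation captures the convex hull of the term $-g\,v_iv_jc + b\,v_iv_js$, i.e. the convex hull of $G$ equals the set of all $(z,v_i,v_j,c,s)\in\mathbb{R}^5$ for which there exist $z_c,z_s\in\mathbb{R}$ and $\lambda^c,\lambda^s\in\mathbb{R}^8$ such that (i) $(z_c,v_i,v_j,c,\lambda^c)$ satisfies the extreme-point relaxation of the trilinear term $v_iv_jc$ over $[v_i^l,v_i^u]\times[v_j^l,v_j^u]\times[c^l,c^u]$; (ii) $(z_s,v_i,v_j,s,\lambda^s)$ satisfies the extreme-point relaxation of the trilinear term $v_iv_js$ over $[v_i^l,v_i^u]\times[v_j^l,v_j^u]\times[s^l,s^u]$; (iii) $z = -g\,z_c + b\,z_s$; (iv) the linking constraint $$(\lambda^c_1+\lambda^c_2-\lambda^s_1-\lambda^s_2)v_i^lv_j^l + (\lambda^c_3+\lambda^c_4-\lambda^s_3-\lambda^s_4)v_i^lv_j^u + (\lambda^c_5+\lambda^c_6-\lambda^s_5-\lambda^s_6)v_i^uv_j^l + (\lambda^c_7+\lambda^c_8-\lambda^s_7-\lambda^s_8)v_i^uv_j^u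 = 0$$ holds.
   Context: Extreme-point relaxation of a trilinear term: given bounds $x_m^l\le x_m\le x_m^u$ for $m=1,2,3$, list the eight vertices of the box in dictionary order: $\xi_1=(x_1^l,x_2^l,x_3^l)$, $\xi_2=(x_1^l,x_2^l,x_3^u)$, $\xi_3=(x_1^l,x_2^u,x_3^l)$, $\xi_4=(x_1^l,x_2^u,x_3^u)$, $\xi_5=(x_1^u,x_2^l,x_3^l)$, $\xi_6=(x_1^u,x_2^l,x_3^u)$, $\xi_7=(x_1^u,x_2^u,x_3^l)$, $\xi_8=(x_1^u,x_2^u,x_3^u)$, and let $\xi_k^m$ be the $m$-th coordinate of $\xi_k$. A tuple $(y,x_1,x_2,x_3,\lambda)$ with $\lambda\in\mathbb{R}^8$ satisfies the extreme-point relaxation of $x_1x_2x_3$ if $y=\sum_{k=1}^8\lambda_k\,\xi_k^1\xi_k^2\xi_k^3$, $x_m=\sum_{k=1}^8\lambda_k\xi_k^m$ for $m=1,2,3$, $\sum_{k=1}^8\lambda_k=1$, and $\lambda_k\ge 0$ for all $k$. In the application, for a branch $(i,j)$ of a power network with admittance $g+\mathbf{i}b$, $v_i,v_j$ are voltage magnitudes and $c,s$ are the lifted variables standing for $\cos\theta_{ij}$ and $\sin\theta_{ij}$, where $\theta_{ij}$ is the phase angle difference. The part of the strengthened QC relaxation modelling the term consists of the constraints (i)-(iv). *)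

(* Defs.v *)
From HB Require Import structures.
From mathcomp Require Import all_boot all_order all_algebra.
From mathcomp Require Import boolp classical_sets reals interval_inference convex.
Set Implicit Arguments.
Unset Strict Implicit.
Unset Printing Implicit Defensive.
Import Order.TTheory GRing.Theory Num.Theory.
Local Open Scope classical_set_scope.
Local Open Scope ring_scope.

Definition convex_hull (R : numDomainType) (M : lmodType R) (A : set M) : set M :=
  smallest (@convex_set R M) A.

(* Row k (0-based) is the vertex xi_{k+1} of the box
   [l1, u1] x [l2, u2] x [l3, u3], in dictionary order; column m holds its
   coordinate of index m + 1. *)
Definition box_vertices (R : realType) (l1 u1 l2 u2 l3 u3 : R) : 'M[R]_(8, 3) :=
  \matrix_(k < 8, m < 3)
    nth 0 (nth [::]
      [:: [:: l1; l2; l3]; [:: l1; l2; u3];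
          [:: l1; u2; l3]; [:: l1; u2; u3];
          [:: u1; l2; l3]; [:: u1; l2; u3];
          [:: u1; u2; l3]; [:: u1; u2; u3]] k) m.

Definition extreme_point_relaxation (R : realType) (l1 u1 l2 u2 l3 u3 : R)
    (y x1 x2 x3 : R) (lambda : 'rV[R]_8) : Prop :=
  let xi := box_vertices l1 u1 l2 u2 l3 u3 in
  y = \sum_(k < 8) lambda 0 k * (xi k 0 * xi k 1 * xi k 2) /\
  x1 = \sum_(k < 8) lambda 0 k * xi k 0 /\
  x2 = \sum_(k < 8) lambda 0 k * xi k 1 /\
  x3 = \sum_(k < 8) lambda 0 k * xi k 2 /\
  \sum_(k < 8) lambda 0 k = 1 /\
  (forall k : 'I_8, 0 <= lambda 0 k).

(* Indices are 0-based: lc 0 k is the (k+1)-st multiplier. Rows 2q and 2q+1 of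
   [box_vertices] share their first two coordinates. *)
Definition linking_constraint (R : realType) (vil viu vjl vju : R)
    (lc ls : 'rV[R]_8) : Prop :=
  (lc 0 0 + lc 0 1 - ls 0 0 - ls 0 1) * (vil * vjl) +
  (lc 0 2 + lc 0 3 - ls 0 2 - ls 0 3) * (vil * vju) +
  (lc 0 4 + lc 0 5 - ls 0 4 - ls 0 5) * (viu * vjl) +
  (lc 0 6 + lc 0 7 - ls 0 6 - ls 0 7) * (viu * vju) = 0.

(* In the next two sets the coordinates of p : 'rV_5 are (z, v_i, v_j, c, s);
   the column indices are numerals of the ring 'I_5. *)
Definition term_graph (R : realType) (g b vil viu vjl vju cl cu sl su : R) :
    set 'rV[R]_5 :=
  [set p | let z := p 0 0 in let vi := p 0 1 in let vj := p 0 2 in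
           let c := p 0 3 in let s := p 0 4 in
    [/\ vil <= vi <= viu, vjl <= vj <= vju, cl <= c <= cu, sl <= s <= su &
        z = - g * vi * vj * c + b * vi * vj * s]].

Definition strengthened_QC (R : realType)
    (g b vil viu vjl vju cl cu sl su : R) : set 'rV[R]_5 :=
  [set p | let z := p 0 0 in let vi := p 0 1 in let vj := p 0 2 in
           let c := p 0 3 in let s := p 0 4 in
    exists (zc zs : R) (lc ls : 'rV[R]_8),
      [/\ extreme_point_relaxation vil viu vjl vju cl cu zc vi vj c lc,
          extreme_point_relaxation vil viu vjl vju sl su zs vi vj s ls,
          z = - g * zc + b * zs &
          linking_constraint vil viu vjl vju lc ls]].

(* Main.v *)
(** The relaxation is convex, being given by linear conditions, and it contains
    the graph: take product barycentric weights.  Conversely, if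
    vil < viu and vjl < vju, then 1, v_i, v_j and v_i v_j are linearly
    independent on the four vertices of the (v_i, v_j)-rectangle, so the
    linking constraint forces lc and ls to put the same mass w_q on each such
    vertex q.  A relaxation point is then the sum over q of w_q times the graph
    point over q whose c- and s-coordinates are the conditional means given q.
    If the rectangle is degenerate, the masses need to agree only after the
    coinciding vertices have been merged, and the same decomposition works. *)

Require Import Defs.
From mathcomp Require Import all_boot all_order all_algebra.
From mathcomp Require Import classical_sets reals.
From mathcomp Require Import interval_inference convex ring lra.
Import Order.TTheory GRing.Theory Num.Theory.
Local Open Scope classical_set_scope.
Local Open Scope ring_scope.

Lemma sum_ord8 (V : nmodType) (f : 'I_8 -> V) :
  \sum_(k < 8) f k = f 0 + f 1 + f 2 + f 3 + f 4 + f 5 + f 6 + f 7.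
Proof.
rewrite !big_ord_recr big_ord0 /= add0r.
by do !congr (_ + _); congr (f _); exact: val_inj.
Qed.

Lemma row5P (T : Type) (u v : 'rV[T]_5) :
  u 0 0 = v 0 0 -> u 0 1 = v 0 1 -> u 0 2 = v 0 2 -> u 0 3 = v 0 3 ->
  u 0 4 = v 0 4 -> u = v.
Proof.
move=> e0 e1 e2 e3 e4; apply/rowP => k.
have : k \in [:: 0; 1; 2; 3; 4] by case: k => -[|[|[|[|[|]]]]].
by rewrite !inE => /orP[|/orP[|/orP[|/orP[]]]] /eqP ->.
Qed.

Lemma itv_barycenter (R : realFieldType) (l u x : R) : l <= x <= u ->
  exists2 t : R, 0 <= t <= 1 & x = (1 - t) * l + t * u.
Proof.
move=> /andP[lx xu]; have [lu|lu] := eqVneq l u.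
  by exists 0; [rewrite lexx ler01|lra].
have lu0 : 0 < u - l by rewrite subr_gt0 lt_neqAle lu (le_trans lx).
exists ((x - l) / (u - l)); last by field; rewrite gt_eqF.
by rewrite ler_pdivlMr// ler_pdivrMr// mul0r mul1r subr_ge0 lx lerB.
Qed.

(** Trades the interval-typed coefficient of [convex_set] for two symmetric nonnegative reals of sum
    1. *)
Lemma convex_setP (R : numDomainType) (M : lmodType R) (A : set M) :
  @convex_set R M A <->
  forall (x y : M) (a b : R), 0 <= a -> 0 <= b -> a + b = 1 ->
    A x -> A y -> A (a *: x + b *: y).
Proof.
split=> [cA x y a b a0 b0 ab Ax Ay|cA x y t].
  have a01 : 0 <= a <= 1 by rewrite a0 -ab lerDl.
  have := cA x y (Itv01 (andP a01).1 (andP a01).2).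
  rewrite !inE => /(_ Ax Ay); rewrite /conv /=.
  have -> : b = 1 - a by rewrite -ab addrC addKr.
  exact.
rewrite !inE => Ax Ay.
by apply: (cA x y t%:num (1 - t%:num)) => //; rewrite addrC subrK.
Qed.

(** The slice at height [w] of the cone over [A]. Keeping the weight as a parameter makes zero
    masses harmless. *)
Definition perspective {R : numDomainType} {M : lmodType R} (A : set M)
    (w : R) : set M :=
  [set w *: x | x in A].

(** After division by [w1 + w2] the sum is a convex combination; if [w1 + w2] is zero, both weights
    vanish. Iterating this up to total weight 1 replaces convex combinations of several points. *)
Lemma perspectiveD (R : numFieldType) (M : lmodType R) (A : set M)
    (w1 w2 : R) (x1 x2 : M) :
  @convex_set R M A -> 0 <= w1 -> 0 <= w2 ->
  perspective A w1 x1 -> perspective A w2 x2 ->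
  perspective A (w1 + w2) (x1 + x2).
Proof.
move=> /convex_setP cA w10 w20 [a1 Aa1 <-] [a2 Aa2 <-].
have [w0|w0] := eqVneq (w1 + w2) 0.
  have := w0; move/eqP; rewrite paddr_eq0// => /andP[/eqP -> /eqP ->].
  by exists a1 => //; rewrite !scale0r !addr0 scale0r.
have wp : 0 <= (w1 + w2)^-1 by rewrite invr_ge0 addr_ge0.
exists ((w1 + w2)^-1 * w1 *: a1 + (w1 + w2)^-1 * w2 *: a2).
  by apply: cA => //; rewrite ?mulr_ge0// -mulrDr mulVf.
by rewrite scalerDr !scalerA !mulrA divff// !mul1r.
Qed.

(* For [w != 0] this is [w] times the graph point over
   [(vi, vj, c / w, s / w)]: [c] and [s] are already scaled by [w], while [vi]
   and [vj] are not. *)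
Definition term_point {R : realType} (g b w vi vj c s : R) : 'rV[R]_5 :=
  \row_(k < 5)
    nth 0 [:: - g * vi * vj * c + b * vi * vj * s; w * vi; w * vj; c; s] k.

Lemma perspective_term_point (R : realType)
    (g b vil viu vjl vju cl cu sl su : R) (A : set 'rV[R]_5)
    (w vi vj c s : R) :
  term_graph g b vil viu vjl vju cl cu sl su `<=` A ->
  vil <= vi <= viu -> vjl <= vj <= vju -> cl <= cu -> sl <= su -> 0 <= w ->
  w * cl <= c <= w * cu -> w * sl <= s <= w * su ->
  perspective A w (term_point g b w vi vj c s).
Proof.
move=> GA hvi hvj hc hs; rewrite le_eqVlt => /predU1P[<-|w0] hwc hws.
  (* At weight 0 the bounds squeeze [c] and [s] to 0, so any graph point over [(vi, vj)] is a
     witness; [cl] and [sl] are at hand. *)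
  have -> : c = 0 by lra.
  have -> : s = 0 by lra.
  exists (term_point g b 1 vi vj cl sl).
    by apply: GA; rewrite /term_graph /= !mxE /= !mul1r !lexx hc hs.
  by apply: row5P; rewrite !mxE /=; ring.
exists (term_point g b 1 vi vj (c / w) (s / w)).
  apply: GA; rewrite /term_graph /= !mxE /= !mul1r; split=> //.
  - by rewrite ler_pdivlMr// ler_pdivrMr// ![_ * w]mulrC.
  - by rewrite ler_pdivlMr// ler_pdivrMr// ![_ * w]mulrC.
by apply: row5P; rewrite !mxE /=; field; rewrite ?gt_eqF.
Qed.

Definition barycentric_weights {R : realType} (t1 t2 t3 : R) : 'rV[R]_8 :=
  \row_(k < 8) nth 0
    [:: (1 - t1) * (1 - t2) * (1 - t3); (1 - t1) * (1 - t2) * t3;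
        (1 - t1) * t2 * (1 - t3); (1 - t1) * t2 * t3;
        t1 * (1 - t2) * (1 - t3); t1 * (1 - t2) * t3;
        t1 * t2 * (1 - t3); t1 * t2 * t3] k.

(** The weights are products, so the vertex sum of a product of coordinates factors into
    one-dimensional interpolations. *)
Lemma extreme_point_relaxation_barycentric (R : realType)
    (l1 u1 l2 u2 l3 u3 t1 t2 t3 : R) :
  0 <= t1 <= 1 -> 0 <= t2 <= 1 -> 0 <= t3 <= 1 ->
  let x1 := (1 - t1) * l1 + t1 * u1 in
  let x2 := (1 - t2) * l2 + t2 * u2 in
  let x3 := (1 - t3) * l3 + t3 * u3 in
  extreme_point_relaxation l1 u1 l2 u2 l3 u3 (x1 * x2 * x3) x1 x2 x3
    (barycentric_weights t1 t2 t3).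
Proof.
move=> /andP[t10 t11] /andP[t20 t21] /andP[t30 t31] x1 x2 x3.
rewrite /extreme_point_relaxation !sum_ord8 !mxE /=.
do 5 (split; first by rewrite /x1 /x2 /x3; ring).
move=> k; rewrite mxE; case: k => -[|[|[|[|[|[|[|[|//]]]]]]]] _ /=;
  by rewrite !mulr_ge0 ?subr_ge0.
Qed.

Lemma extreme_point_relaxation_conv (R : realType) (l1 u1 l2 u2 l3 u3 : R)
    (y x1 x2 x3 y' x1' x2' x3' a b : R) (la la' : 'rV[R]_8) :
  0 <= a -> 0 <= b -> a + b = 1 ->
  extreme_point_relaxation l1 u1 l2 u2 l3 u3 y x1 x2 x3 la ->
  extreme_point_relaxation l1 u1 l2 u2 l3 u3 y' x1' x2' x3' la' ->
  extreme_point_relaxation l1 u1 l2 u2 l3 u3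
    (a * y + b * y') (a * x1 + b * x1') (a * x2 + b * x2') (a * x3 + b * x3')
    (a *: la + b *: la').
Proof.
move=> a0 b0 ab [-> [-> [-> [-> [s1 la0]]]]] [-> [-> [-> [-> [s1' la0']]]]].
have comb (F : 'I_8 -> R) : \sum_k (a *: la + b *: la') 0 k * F k =
    a * (\sum_k la 0 k * F k) + b * (\sum_k la' 0 k * F k).
  by rewrite !mulr_sumr -big_split; apply: eq_bigr => k _ /=; rewrite !mxE; ring.
do 4 (split; first by rewrite comb).
split; last by move=> k; rewrite !mxE addr_ge0// mulr_ge0.
(* The total mass is [comb] for the constant function 1. *)
by have := comb (fun=> 1); rewrite -!mulr_suml s1 s1' !mulr1 ab.
Qed.

Lemma convex_strengthened_QC (R : realType)
    (g b vil viu vjl vju cl cu sl su : R) :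
  @convex_set R 'rV[R]_5 (strengthened_QC g b vil viu vjl vju cl cu sl su).
Proof.
apply/convex_setP => p q t u t0 u0 tu.
move=> [zc [zs [lc [ls [pc ps pz pl]]]]] [zc' [zs' [lc' [ls' [qc qs qz ql]]]]].
exists (t * zc + u * zc'), (t * zs + u * zs'), (t *: lc + u *: lc'),
  (t *: ls + u *: ls'); rewrite !mxE; split.
- exact: extreme_point_relaxation_conv.
- exact: extreme_point_relaxation_conv.
- by rewrite pz qz; ring.
- rewrite /linking_constraint; transitivity (t * 0 + u * 0); last by ring.
  by rewrite -{1}pl -ql !mxE; ring.
Qed.

Lemma term_graph_sub_QC (R : realType)
    (g b vil viu vjl vju cl cu sl su : R) :
  term_graph g b vil viu vjl vju cl cu sl su `<=`
  strengthened_QC g b vil viu vjl vju cl cu sl su.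
Proof.
move=> p [/itv_barycenter[ti ti01 ei] /itv_barycenter[tj tj01 ej]].
move=> /itv_barycenter[tc tc01 ec] /itv_barycenter[ts ts01 es] ez.
exists (p 0 1 * p 0 2 * p 0 3), (p 0 1 * p 0 2 * p 0 4).
exists (barycentric_weights ti tj tc), (barycentric_weights ti tj ts).
split.
- by rewrite ei ej ec; exact: extreme_point_relaxation_barycentric.
- by rewrite ei ej es; exact: extreme_point_relaxation_barycentric.
- by rewrite ez; ring.
(* Summing a pair of weights removes the third factor, so both marginals depend on [ti] and [tj]
   only. *)
- by rewrite /linking_constraint !mxE /=; ring.
Qed.

(** Testing against [(x1 - l1) * (x2 - l2)], which vanishes at every vertex but the last, isolates
    [d4]; then [l1 - x1] and [l2 - x2] give [d3] and [d2]. *)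
Lemma bilinear_eq0 (F : fieldType) (l1 u1 l2 u2 d1 d2 d3 d4 : F) :
  l1 != u1 -> l2 != u2 ->
  d1 + d2 + d3 + d4 = 0 ->
  d1 * l1 + d2 * l1 + d3 * u1 + d4 * u1 = 0 ->
  d1 * l2 + d2 * u2 + d3 * l2 + d4 * u2 = 0 ->
  d1 * (l1 * l2) + d2 * (l1 * u2) + d3 * (u1 * l2) + d4 * (u1 * u2) = 0 ->
  [/\ d1 = 0, d2 = 0, d3 = 0 & d4 = 0].
Proof.
rewrite -(subr_eq0 l1) -(subr_eq0 l2) => n1 n2 e e1 e2 e12.
have d40 : d4 = 0.
  apply: (mulfI n1); apply: (mulfI n2).
  transitivity (0 - l2 * 0 - l1 * 0 + l1 * l2 * 0 : F); last by ring.
  by rewrite -{1}e12 -{1}e1 -{1}e2 -e; ring.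
have d30 : d3 = 0.
  apply: (mulfI n1); rewrite mulr0.
  transitivity (l1 * 0 - 0 - (l1 - u1) * d4 : F); last by rewrite d40; ring.
  by rewrite -{1}e -e1; ring.
have d20 : d2 = 0.
  apply: (mulfI n2); rewrite mulr0.
  transitivity (l2 * 0 - 0 - (l2 - u2) * d4 : F); last by rewrite d40; ring.
  by rewrite -{1}e -e2; ring.
by split=> //; rewrite d20 d30 d40 !addr0 in e.
Qed.

Lemma QC_sub_convex (R : realType) (g b vil viu vjl vju cl cu sl su : R)
    (A : set 'rV[R]_5) :
  vil <= viu -> vjl <= vju -> cl <= cu -> sl <= su ->
  @convex_set R 'rV[R]_5 A ->
  term_graph g b vil viu vjl vju cl cu sl su `<=` A ->
  strengthened_QC g b vil viu vjl vju cl cu sl su `<=` A.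
Proof.
move=> hvi hvj hc hs cA GA p [zc [zs [lc [ls [pc ps pz]]]]].
move: pc ps; rewrite /extreme_point_relaxation /linking_constraint.
rewrite !sum_ord8 !mxE /=.
move=> [ezc [eic [ejc [ec [sc lc0]]]]] [ezs [eis [ejs [es [ss ls0]]]]] link.
move: (lc0 0) (lc0 1) (lc0 2) (lc0 3) (lc0 4) (lc0 5) (lc0 6) (lc0 7).
move: (ls0 0) (ls0 1) (ls0 2) (ls0 3) (ls0 4) (ls0 5) (ls0 6) (ls0 7).
move: pz ezc eic ejc ec sc ezs eis ejs es ss link => {lc0 ls0}.
move: (lc 0 0) (lc 0 1) (lc 0 2) (lc 0 3) (lc 0 4) (lc 0 5) (lc 0 6) (lc 0 7).
move: (ls 0 0) (ls 0 1) (ls 0 2) (ls 0 3) (ls 0 4) (ls 0 5) (ls 0 6) (ls 0 7).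
move=> s0 s1 s2 s3 s4 s5 s6 s7 c0 c1 c2 c3 c4 c5 c6 c7.
move=> pz ezc eic ejc ec sc ezs eis ejs es ss link.
move=> s0p s1p s2p s3p s4p s5p s6p s7p c0p c1p c2p c3p c4p c5p c6p c7p.
(* Membership in [A] is weight 1 in the cone, which can be split along the vertex masses. *)
suff [a Aa <-] : perspective A 1 p by rewrite scale1r.
have hil : vil <= vil <= viu by rewrite lexx.
have hiu : vil <= viu <= viu by rewrite lexx andbT.
have hjl : vjl <= vjl <= vju by rewrite lexx.
have hju : vjl <= vju <= vju by rewrite lexx andbT.
have mem2 x y (l u : R) : l <= u -> 0 <= x -> 0 <= y ->
    (x + y) * l <= x * l + y * u <= (x + y) * u.
  by move=> lu x0 y0; rewrite !mulrDl lerD2l lerD2r !ler_wpM2l.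
have mem4 x y z t (l u : R) : l <= u -> 0 <= x -> 0 <= y -> 0 <= z -> 0 <= t ->
    (x + y + z + t) * l <= x * l + y * u + z * l + t * u <= (x + y + z + t) * u.
  move=> lu x0 y0 z0 t0; have := mem2 x y l u lu x0 y0.
  by have := mem2 z t l u lu z0 t0; lra.
have G w vi vj c s := @perspective_term_point R g b vil viu vjl vju cl cu sl su
  A w vi vj c s GA.
have [ei|ni] := eqVneq vil viu; have [ej|nj] := eqVneq vjl vju.
(* The rectangle is one point, which carries all the mass. *)
- have -> : p = term_point g b 1 vil vjl (p 0 3) (p 0 4).
    apply: row5P; rewrite !mxE //= ?mul1r.
    + rewrite pz ezc ezs ec es -ei -ej; ring.
    + by rewrite eic -ei -!mulrDl sc mul1r.
    + by rewrite ejc -ej -!mulrDl sc mul1r.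
  apply: G => //; [rewrite ec -sc|rewrite es -ss].
  + have := mem4 c0 c1 c2 c3 _ _ hc c0p c1p c2p c3p.
    by have := mem4 c4 c5 c6 c7 _ _ hc c4p c5p c6p c7p; lra.
  + have := mem4 s0 s1 s2 s3 _ _ hs s0p s1p s2p s3p.
    by have := mem4 s4 s5 s6 s7 _ _ hs s4p s5p s6p s7p; lra.
(* Vertices with the same [v_j] coincide. The mass at [vju] is determined by [p 0 2] and the total
   mass 1, hence is the same for both multipliers. *)
- have wE : s0 + s1 + s4 + s5 = c0 + c1 + c4 + c5 /\
            s2 + s3 + s6 + s7 = c2 + c3 + c6 + c7.
    have : (c2 + c3 + c6 + c7 - (s2 + s3 + s6 + s7)) * (vju - vjl) = 0.
      transitivity (p 0 2 - p 0 2 - vjl * (1 - 1)); last by ring.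
      by rewrite {1}ejc ejs -{1}sc -ss; ring.
    move/eqP; rewrite mulf_eq0 (subr_eq0 vju) [vju == _]eq_sym (negPf nj) orbF.
    by move=> /eqP; lra.
  have -> : p =
      term_point g b (c0 + c1 + c4 + c5) vil vjl
        (c0 * cl + c1 * cu + c4 * cl + c5 * cu)
        (s0 * sl + s1 * su + s4 * sl + s5 * su) +
      term_point g b (c2 + c3 + c6 + c7) vil vju
        (c2 * cl + c3 * cu + c6 * cl + c7 * cu)
        (s2 * sl + s3 * su + s6 * sl + s7 * su).
    by apply: row5P; rewrite !mxE //= ?pz ?ezc ?ezs ?eic ?ejc ?ec ?es -?ei; ring.
  have -> : 1 = (c0 + c1 + c4 + c5) + (c2 + c3 + c6 + c7) by rewrite -sc; ring.
  (* The weights are sums of the [c] multipliers; [wE] turns them into sums of the [s] multipliers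
     for the bounds on the last coordinate. *)
  apply: perspectiveD => //; rewrite ?addr_ge0//; apply: G => //;
    rewrite ?addr_ge0 ?mem4// -?wE.1 -?wE.2; exact: mem4.
(* Symmetric case: vertices with the same [v_i] coincide, and [p 0 1] determines the mass at
   [viu]. *)
- have wE : s0 + s1 + s2 + s3 = c0 + c1 + c2 + c3 /\
            s4 + s5 + s6 + s7 = c4 + c5 + c6 + c7.
    have : (c4 + c5 + c6 + c7 - (s4 + s5 + s6 + s7)) * (viu - vil) = 0.
      transitivity (p 0 1 - p 0 1 - vil * (1 - 1)); last by ring.
      by rewrite {1}eic eis -{1}sc -ss; ring.
    move/eqP; rewrite mulf_eq0 (subr_eq0 viu) [viu == _]eq_sym (negPf ni) orbF.
    by move=> /eqP; lra.
  have -> : p =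
      term_point g b (c0 + c1 + c2 + c3) vil vjl
        (c0 * cl + c1 * cu + c2 * cl + c3 * cu)
        (s0 * sl + s1 * su + s2 * sl + s3 * su) +
      term_point g b (c4 + c5 + c6 + c7) viu vjl
        (c4 * cl + c5 * cu + c6 * cl + c7 * cu)
        (s4 * sl + s5 * su + s6 * sl + s7 * su).
    by apply: row5P; rewrite !mxE //= ?pz ?ezc ?ezs ?eic ?ejc ?ec ?es -?ej; ring.
  have -> : 1 = (c0 + c1 + c2 + c3) + (c4 + c5 + c6 + c7) by rewrite -sc; ring.
  apply: perspectiveD => //; rewrite ?addr_ge0//; apply: G => //;
    rewrite ?addr_ge0 ?mem4// -?wE.1 -?wE.2; exact: mem4.
(* The three remaining moment equations come from equating the two expressions for 1, [p 0 1] and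
   [p 0 2]. *)
- have [] := @bilinear_eq0 R vil viu vjl vju (c0 + c1 - s0 - s1)
    (c2 + c3 - s2 - s3) (c4 + c5 - s4 - s5) (c6 + c7 - s6 - s7) ni nj _ _ _ link.
  + by transitivity (1 - 1 : R); [rewrite -{1}sc -ss|]; ring.
  + by transitivity (p 0 1 - p 0 1); [rewrite {1}eic eis|]; ring.
  + by transitivity (p 0 2 - p 0 2); [rewrite {1}ejc ejs|]; ring.
  move=> d1 d2 d3 d4.
  have [w1 w2] : s0 + s1 = c0 + c1 /\ s2 + s3 = c2 + c3 by lra.
  have [w3 w4] : s4 + s5 = c4 + c5 /\ s6 + s7 = c6 + c7 by lra.
  have -> : p =
      term_point g b (c0 + c1) vil vjl (c0 * cl + c1 * cu) (s0 * sl + s1 * su) +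
      term_point g b (c2 + c3) vil vju (c2 * cl + c3 * cu) (s2 * sl + s3 * su) +
      term_point g b (c4 + c5) viu vjl (c4 * cl + c5 * cu) (s4 * sl + s5 * su) +
      term_point g b (c6 + c7) viu vju (c6 * cl + c7 * cu) (s6 * sl + s7 * su).
    by apply: row5P; rewrite !mxE //= ?pz ?ezc ?ezs ?eic ?ejc ?ec ?es; ring.
  have -> : 1 = (c0 + c1) + (c2 + c3) + (c4 + c5) + (c6 + c7).
    by rewrite -sc; ring.
  do 3? (apply: perspectiveD => //); rewrite ?addr_ge0//; apply: G => //;
    rewrite ?addr_ge0 ?mem2// -?w1 -?w2 -?w3 -?w4; exact: mem2.
Qed.

Theorem theorem2 (R : realType) (g b vil viu vjl vju cl cu sl su : R)
    (hvi : vil <= viu) (hvj : vjl <= vju) (hc : cl <= cu) (hs : sl <= su) :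
  convex_hull (term_graph g b vil viu vjl vju cl cu sl su) =
  strengthened_QC g b vil viu vjl vju cl cu sl su.
Proof.
apply/seteqP; split.
  apply: smallest_sub; first exact: convex_strengthened_QC.
  exact: term_graph_sub_QC.
(* Membership in the hull is tested on each convex [A] containing the graph. *)
by move=> p QCp A [cA GA]; exact: QC_sub_convex QCp.
Qed.
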